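(* As $n\to\infty$ over powers of two, there is a single real polynomial, in the $2n^2$ bits of $x$ and the $(1+M)\log n$ descriptor bits of $(j,A)$, of degree $O(\sqrt{n+L}\,\log^3 n)=\widetilde{O}(\sqrt n)$ that $\tfrac13$-approximates the predicate $\varphi_0$ defined in the context (i.e. differs from $\varphi_0$ by at most $\tfrac13$ at every Boolean input); hence $\widetilde{\deg}(\varphi_0)=\widetilde{O}(\sqrt n)$.
   Context: Parameters. $n=2^\ell$ is a power of two, large enough that $\ell=\log_2 n\ge5$; $M:=\lfloor n^{(\ell+1)/(\ell+2)}\rfloor$ (so $1\le M<n$) and $L:=\ell n$. Fix a bijection between $\{0,1\}^\ell$ and $[n]=\{1,\dots,n\}$, so that each $\ell$-bit string names an element of $[n]$. Fix maps $r_1,\dots,r_\ell:[n]\times[n]\to[n]$ with the property (such maps exist) that for every $S\subseteq[n]$ with $|S|\le n^{(\ell+1)/(\ell+2)}$, $|\{(i,j)\in S\times S:\ r_k(i,j)\in S\ \forall k\in[\ell]\}|\le L$. Inputs. $x\in\{0,1\}^{2n^2}$ has coordinates $x_{i,j,b}$, $i,j\in[n]$, $b\in\{1,2\}$. Membership. For a list $A=(a_1,\dots,a_M)\in[n]^M$ (not necessarily sorted) and $i\in[n]$, $\operatorname{mem}_A(i)\in\{0,1\}$ is the output of this search: start with $\lambda=1,\mu=M+1$; while $\lambda<\mu$, let $m=\lfloor(\lambda+\mu)/2\rfloor$, and if $a_m<i$ set $\lambda:=m+1$, else set $\mu:=m$; at the end output $1$ iff $\lambda\le M$ and $a_\lambda=i$.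 Descriptors and validity. A canonical $0$-certificate descriptor is a pair $(j,A)$ with $j\in[n]$, $A\in[n]^M$, encoded by $(1+M)\log n$ bits. For $u\ne v$ let $E_A(u,v)=\operatorname{mem}_A(u)\operatorname{mem}_A(v)\prod_{k=1}^\ell\operatorname{mem}_A(r_k(u,v))$, $Z_{u,v}=(1-x_{u,v,1})(1-x_{v,v,2})$, and $W(A,x)=\sum_{u\neq v}E_A(u,v)(1-Z_{u,v})$, the sum over ordered pairs of distinct $u,v\in[n]$. The descriptor $(j,A)$ is valid on $x$ if (K) for all $i\in[n]$, $\operatorname{mem}_A(i)=1$ or $(x_{i,j,1},x_{i,j,2})=(0,0)$; and (R) $W(A,x)=0$. The total predicate $\varphi_0(x,(j,A))$ equals $1$ iff $(j,A)$ is valid on $x$, and $0$ otherwise. For a total Boolean function $g$ on $\{0,1\}^N$, $\widetilde{\deg}(g)$ is the least degree of a real polynomial $p$ with $|p(x)-g(x)|\le1/3$ for all $x\in\{0,1\}^N$. $\widetilde O$ suppresses factors polylogarithmic in $n$; logarithms are base $2$. *)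

(* Defs.v *)
From HB Require Import structures.
From mathcomp Require Import all_boot all_order all_algebra.
From mathcomp Require Import boolp reals mpoly exp.
From mathcomp Require Import zify.

Set Implicit Arguments.
Unset Strict Implicit.
Unset Printing Implicit Defensive.

Import Order.TTheory GRing.Theory Num.Theory.

Local Open Scope ring_scope.

(** * Approximate degree

    The Boolean cube {0,1}^N is [{ffun I -> bool}] for a finite index type [I]
    with N elements; the polynomial variable ['X_k] stands for the coordinate
    [enum_val k]. *)

Definition cube_eval (R : realType) (I : finType) (p : {mpoly R[#|I|]})
    (z : {ffun I -> bool}) : R :=
  p.@[fun k => (z (enum_val k))%:R].

Definition approximates (R : realType) (I : finType) (p : {mpoly R[#|I|]})
    (g : {ffun I -> bool} -> bool) : Prop :=
  forall z, `|cube_eval p z - (g z)%:R| <= 3^-1.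

(* [msize] is one more than the degree; the zero polynomial gets degree 0. *)
Definition mpoly_degree (R : realType) (N : nat) (p : {mpoly R[N]}) : nat :=
  (msize p).-1.

Definition has_approx_degree (R : realType) (I : finType)
    (g : {ffun I -> bool} -> bool) (d : nat) : bool :=
  `[< exists p : {mpoly R[#|I|]}, approximates p g /\ mpoly_degree p = d >].

Lemma has_approx_degree_ex (R : realType) (I : finType)
    (g : {ffun I -> bool} -> bool) : exists d, has_approx_degree R g d.
Proof.
pose p : {mpoly R[#|I|]} := \sum_(z | g z) \prod_(k < #|I|)
  (if z (enum_val k) then 'X_k else 1 - 'X_k).
exists (mpoly_degree p); apply/asboolP; exists p; split=> // w.
suff -> : cube_eval p w = (g w)%:R by rewrite subrr normr0 invr_ge0 ler0n.
have prodE (z : {ffun I -> bool}) : (\prod_(k < #|I|)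
    (if z (enum_val k) then 'X_k else 1 - 'X_k : {mpoly R[#|I|]})).@[
      fun k => (w (enum_val k))%:R] = (z == w)%:R.
  rewrite rmorph_prod /=; case: eqVneq => [->|neq_zw].
    rewrite big1 // => k _; case wk: (w _); first by rewrite mevalXU wk.
    by rewrite mevalB meval1 mevalXU wk subr0.
  have [i neq_i] : exists i, z i != w i.
    apply/existsP; rewrite -negb_forall; apply: contra neq_zw.
    by move=> /forallP eq_zw; apply/eqP; apply/ffunP=> i; apply/eqP.
  rewrite (bigD1 (enum_rank i)) //= enum_rankK.
  case: (z i) neq_i => wi; rewrite ?mevalB ?meval1 mevalXU enum_rankK;
    by case: (w i) wi => //= _; rewrite ?subrr mul0r.
rewrite /cube_eval /p rmorph_sum /= (eq_bigr _ (fun z _ => prodE z)).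
case gw: (g w).
  rewrite (bigD1 w) //= eqxx big1 ?addr0 // => z /andP[_ /negPf->] //.
by rewrite big1 // => z gz; case: eqP gz => // ->; rewrite gw.
Qed.

Definition approx_degree (R : realType) (I : finType)
    (g : {ffun I -> bool} -> bool) : nat :=
  ex_minn (has_approx_degree_ex R g).

(** * Parameters

    Throughout n = 2 ^ l, and [n] = {1, ..., n} is the ordinal type ['I_(2 ^ l)],
    i.e. values are shifted down by one. *)

(* The real number n^((l+1)/(l+2)). *)
Definition list_bound (R : realType) (l : nat) : R :=
  (2 ^ l)%:R `^ (l.+1%:R / l.+2%:R).

(* M *)
Definition list_len (R : realType) (l : nat) : nat :=
  Num.truncn (list_bound R l).

(* L *)
Definition pair_bound (l : nat) : nat := (l * 2 ^ l)%N.

Definition sparse_maps (R : realType) (l : nat)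
    (r : 'I_l -> 'I_(2 ^ l) -> 'I_(2 ^ l) -> 'I_(2 ^ l)) : Prop :=
  forall S : {set 'I_(2 ^ l)}, #|S|%:R <= list_bound R l ->
    (#|[set ij in setX S S | [forall k, r k ij.1 ij.2 \in S]]|
      <= pair_bound l)%N.

(** * Membership by binary search *)

Fixpoint search_fuel (a : nat -> nat) (i fuel lo hi : nat) : nat :=
  if fuel is f.+1 then
    if (lo < hi)%N then
      let m := (lo + hi)./2 in
      if (a m < i)%N then search_fuel a i f m.+1 hi else search_fuel a i f lo m
    else lo
  else lo.

Definition search (a : nat -> nat) (i lo hi : nat) : nat :=
  search_fuel a i (hi - lo) lo hi.

(* The fuel never runs out: [search] runs the while loop to completion. *)
Lemma searchE a i lo hi :
  search a i lo hi =
    if (lo < hi)%N then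
      let m := (lo + hi)./2 in
      if (a m < i)%N then search a i m.+1 hi else search a i lo m
    else lo.
Proof.
have fuelE f1 f2 x y : (y - x <= f1)%N -> (y - x <= f2)%N ->
    search_fuel a i f1 x y = search_fuel a i f2 x y.
  elim: f1 f2 x y => [|f1 IH] [|f2] x y //= le1 le2;
    case: ltnP => //= lt_xy; try lia.
  by case: ifP => _; apply: IH; lia.
rewrite {1}/search.
case: ltnP => [lt_lh|le_hl]; last by have -> : (hi - lo = 0)%N by lia.
case Ef: (hi - lo)%N => [|f]; first lia.
by rewrite /= lt_lh; case: ifP => _; apply: fuelE; lia.
Qed.

(* List positions run from 1 to M, so a_m is the entry number m - 1 of [A]; the
   search only reads positions in that range. *)
Definition mem_list (n M : nat) (A : M.-tuple 'I_n) (i : 'I_n) : bool :=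
  let a := fun m => nth 0%N (map val A) m.-1 in
  let pos := search a i 1 M.+1 in
  (pos <= M)%N && (a pos == i).

(** * Descriptors and validity *)

(* [x (i, j, false)] is x_{i,j,1} and [x (i, j, true)] is x_{i,j,2}. *)
Definition xcoord (l : nat) : finType := ('I_(2 ^ l) * 'I_(2 ^ l) * bool)%type.

Definition edge (l M : nat) (r : 'I_l -> 'I_(2 ^ l) -> 'I_(2 ^ l) -> 'I_(2 ^ l))
    (A : M.-tuple 'I_(2 ^ l)) (u v : 'I_(2 ^ l)) : int :=
  (mem_list A u)%:R * (mem_list A v)%:R *
  \prod_(k < l) (mem_list A (r k u v))%:R.

Definition zprod (l : nat) (x : {ffun xcoord l -> bool})
    (u v : 'I_(2 ^ l)) : int :=
  (1 - (x (u, v, false))%:R) * (1 - (x (v, v, true))%:R).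

Definition weight (l M : nat)
    (r : 'I_l -> 'I_(2 ^ l) -> 'I_(2 ^ l) -> 'I_(2 ^ l))
    (A : M.-tuple 'I_(2 ^ l)) (x : {ffun xcoord l -> bool}) : int :=
  \sum_(uv : 'I_(2 ^ l) * 'I_(2 ^ l) | uv.1 != uv.2)
    edge r A uv.1 uv.2 * (1 - zprod x uv.1 uv.2).

Definition valid (l M : nat)
    (r : 'I_l -> 'I_(2 ^ l) -> 'I_(2 ^ l) -> 'I_(2 ^ l))
    (x : {ffun xcoord l -> bool}) (j : 'I_(2 ^ l))
    (A : M.-tuple 'I_(2 ^ l)) : bool :=
  [forall i, mem_list A i ||
     ((x (i, j, false), x (i, j, true)) == (false, false))]
  && (weight r A x == 0).

(** * The total predicate

    A descriptor consists of M + 1 blocks of l bits: block [None] names j and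
    block [Some m] names the entry number m of A. *)

Definition dcoord (l M : nat) : finType := (option 'I_M * 'I_l)%type.

Definition icoord (l M : nat) : finType := (xcoord l + dcoord l M)%type.

Lemma card_icoord (l M : nat) :
  #|icoord l M| = (2 * (2 ^ l) ^ 2 + M.+1 * l)%N.
Proof.
by rewrite card_sum !card_prod card_option card_bool !card_ord mulnC mulnn.
Qed.

Definition input_part (l M : nat) (z : {ffun icoord l M -> bool}) :
    {ffun xcoord l -> bool} :=
  [ffun q => z (inl q)].

Definition desc_block (l M : nat) (z : {ffun icoord l M -> bool})
    (m : option 'I_M) : {ffun 'I_l -> bool} :=
  [ffun t => z (inr (m, t))].

(* [name] is the fixed bijection between l-bit strings and [n]. *)
Definition phi0 (l M : nat) (name : {ffun 'I_l -> bool} -> 'I_(2 ^ l))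
    (r : 'I_l -> 'I_(2 ^ l) -> 'I_(2 ^ l) -> 'I_(2 ^ l))
    (z : {ffun icoord l M -> bool}) : bool :=
  valid r (input_part z) (name (desc_block z None))
    [tuple name (desc_block z (Some m)) | m < M].

(* Main.v *)
Require Import Defs.
From HB Require Import structures.
From mathcomp Require Import all_boot all_order all_algebra.
From mathcomp Require Import boolp reals mpoly exp.
From mathcomp Require Import zify ring lra.

Set Implicit Arguments.
Unset Strict Implicit.
Unset Printing Implicit Defensive.

Import Order.TTheory GRing.Theory Num.Theory.

Local Open Scope ring_scope.

(* The number of violated conditions of (K) and (R) vanishes exactly on valid
   descriptors. As a function of the bits of (x, j, A) it is a polynomial of
   degree O(l^3), because binary search is a decision tree that reads O(l) list
   entries of l bits each. It never exceeds n + L: the indices i with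
   mem_A(i) = 1 all occur in A, so there are at most M of them and the maps r_k
   leave at most L pairs to count. Composing with a univariate Chebyshev
   polynomial of degree O(sqrt (n + L)) that separates 0 from {1, ..., n + L}
   gives the approximation. *)

(** * Degree of functions on the Boolean cube *)

(** Agreement is asked only on Boolean points. As [msize] is the degree plus one, the bound reads
    degree at most [d] and admits the zero polynomial for every [d]. *)
Definition cube_degree_le (R : realType) (I : finType) (d : nat)
    (f : {ffun I -> bool} -> R) : Prop :=
  exists2 p : {mpoly R[#|I|]}, cube_eval p =1 f & (msize p <= d.+1)%N.

Section CubeDegree.

Variables (R : realType) (I : finType).
Implicit Types (f g : {ffun I -> bool} -> R) (d e : nat).

Lemma cube_degree_ext d f g :
  f =1 g -> cube_degree_le d f -> cube_degree_le d g.
Proof. by move=> eq_fg [p pE ps]; exists p => // z; rewrite pE eq_fg. Qed.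

Lemma cube_degree_weaken d e f :
  (d <= e)%N -> cube_degree_le d f -> cube_degree_le e f.
Proof. by move=> le_de [p pE ps]; exists p => //; apply: leq_trans ps _. Qed.

Lemma cube_degree_cst d (c : R) :
  cube_degree_le d (fun _ : {ffun I -> bool} => c).
Proof.
exists c%:MP => [z|]; first by rewrite /cube_eval mevalC.
by rewrite msizeC; case: (c != 0).
Qed.

Lemma cube_degree_coord (i : I) : @cube_degree_le R I 1 (fun z => (z i)%:R).
Proof.
exists 'X_(enum_rank i) => [z|]; last by rewrite msizeX mdeg1.
by rewrite /cube_eval mevalXU enum_rankK.
Qed.

Lemma cube_degreeD d f g :
  cube_degree_le d f -> cube_degree_le d g ->
  cube_degree_le d (fun z => f z + g z).
Proof.
move=> [p pE ps] [q qE qs]; exists (p + q) => [z|].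
  by rewrite -pE -qE /cube_eval mevalD.
by apply: leq_trans (msizeD_le _ _) _; rewrite geq_max ps qs.
Qed.

Lemma cube_degreeM d e f g :
  cube_degree_le d f -> cube_degree_le e g ->
  cube_degree_le (d + e) (fun z => f z * g z).
Proof.
move=> [p pE ps] [q qE qs]; exists (p * q) => [z|].
  by rewrite -pE -qE /cube_eval mevalM.
have [->|p0] := eqVneq p 0; first by rewrite mul0r msize0.
have [->|q0] := eqVneq q 0; first by rewrite mulr0 msize0.
by rewrite msizeM // -subn1 leq_subLR add1n -addnS -addSn leq_add.
Qed.

Lemma cube_degreeZ d (c : R) f :
  cube_degree_le d f -> cube_degree_le d (fun z => c * f z).
Proof. by move=> df; apply: (@cube_degreeM 0) => //; apply: cube_degree_cst. Qed.

Lemma cube_degree_sum (T : Type) (s : seq T) (P : pred T)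
    (F : T -> {ffun I -> bool} -> R) d :
  (forall t, P t -> cube_degree_le d (F t)) ->
  cube_degree_le d (fun z => \sum_(t <- s | P t) F t z).
Proof.
move=> dF; elim: s => [|t s IH].
  by apply: cube_degree_ext (cube_degree_cst d 0) => z; rewrite big_nil.
case Pt: (P t).
  apply: cube_degree_ext (cube_degreeD (dF t Pt) IH) => z.
  by rewrite big_cons Pt.
by apply: cube_degree_ext IH => z; rewrite big_cons Pt.
Qed.

Lemma cube_degree_prod (T : finType) (F : T -> {ffun I -> bool} -> R) d :
  (forall t, cube_degree_le d (F t)) ->
  cube_degree_le (#|T| * d) (fun z => \prod_t F t z).
Proof.
move=> dF; rewrite cardT enumT /index_enum.
elim: (Finite.enum T) => [|t s IH].
  by apply: cube_degree_ext (cube_degree_cst _ 1) => z; rewrite big_nil.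
rewrite mulSn; apply: cube_degree_ext (cube_degreeM (dF t) IH) => z.
by rewrite big_cons.
Qed.

Lemma cube_degree_negb d (b : {ffun I -> bool} -> bool) :
  cube_degree_le d (fun z => (b z)%:R : R) ->
  cube_degree_le d (fun z => (~~ b z)%:R : R).
Proof.
move=> db.
apply: cube_degree_ext (cube_degreeD (cube_degree_cst d 1)
  (cube_degreeZ (-1) db)) => z.
by case: (b z); rewrite ?mulr1 ?mulr0 ?subrr ?addr0.
Qed.

Lemma cube_degree_andb d e (b c : {ffun I -> bool} -> bool) :
  cube_degree_le d (fun z => (b z)%:R : R) ->
  cube_degree_le e (fun z => (c z)%:R : R) ->
  cube_degree_le (d + e) (fun z => (b z && c z)%:R : R).
Proof.
move=> db dc; apply: cube_degree_ext (cube_degreeM db dc) => z.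
by rewrite -natrM mulnb.
Qed.

Lemma cube_degree_orb d e (b c : {ffun I -> bool} -> bool) :
  cube_degree_le d (fun z => (b z)%:R : R) ->
  cube_degree_le e (fun z => (c z)%:R : R) ->
  cube_degree_le (d + e) (fun z => (b z || c z)%:R : R).
Proof.
move=> db dc; apply: cube_degree_ext (cube_degree_negb
  (cube_degree_andb (cube_degree_negb db) (cube_degree_negb dc))) => z.
by rewrite negb_and !negbK.
Qed.

Lemma cube_degree_forall (T : finType) d (b : T -> {ffun I -> bool} -> bool) :
  (forall t, cube_degree_le d (fun z => (b t z)%:R : R)) ->
  cube_degree_le (#|T| * d) (fun z => [forall t, b t z]%:R : R).
Proof.
move=> db; apply: cube_degree_ext (cube_degree_prod db) => z.
case: forallP => [bT|/forallP]; first by rewrite big1 // => t _; rewrite bT.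
by rewrite negb_forall => /existsP[t /negPf bF]; rewrite (bigD1 t) //= bF mul0r.
Qed.

Lemma cube_degree_if d e (b : {ffun I -> bool} -> bool) f g :
  cube_degree_le d (fun z => (b z)%:R : R) ->
  cube_degree_le e f -> cube_degree_le e g ->
  cube_degree_le (d + e) (fun z => if b z then f z else g z).
Proof.
move=> db df dg; apply: cube_degree_ext
  (cube_degreeD (cube_degreeM db df) (cube_degreeM (cube_degree_negb db) dg)).
by move=> z; case: (b z); rewrite ?mul1r ?mul0r ?addr0 ?add0r.
Qed.

(** Expand [F (h z) z] as the sum over [t] of [[h z = t] * F t z]: a sum over all values of [h]
    costs no degree. *)
Lemma cube_degree_bind (T : finType) d e (h : {ffun I -> bool} -> T)
    (F : T -> {ffun I -> bool} -> R) :
  (forall t, cube_degree_le d (fun z => (h z == t)%:R : R)) ->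
  (forall t, cube_degree_le e (F t)) ->
  cube_degree_le (d + e) (fun z => F (h z) z).
Proof.
move=> dh dF.
apply: cube_degree_ext (cube_degree_sum (index_enum T) (P := xpredT)
  (fun t _ => cube_degreeM (dh t) (dF t))) => z.
rewrite (bigD1 (h z)) //= eqxx mul1r big1 ?addr0 // => t /negPf.
by rewrite eq_sym => ->; rewrite mul0r.
Qed.

Lemma cube_degree_junta (J : finType) (h : J -> I) (g : {ffun J -> bool} -> R) :
  cube_degree_le #|J| (fun z => g [ffun t => z (h t)]).
Proof.
rewrite -[#|J|]addn0.
apply: (cube_degree_bind (h := fun z : {ffun I -> bool} => [ffun t => z (h t)])
  (F := fun w _ => g w)) => w; last exact: cube_degree_cst.
rewrite -[#|J|]muln1.
apply: (@cube_degree_ext _ (fun z => [forall t, z (h t) == w t]%:R)).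
  move=> z; congr (nat_of_bool _)%:R; apply/forallP/eqP => [zw|<- t].
    by apply/ffunP => t; rewrite ffunE; apply/eqP.
  by rewrite ffunE.
apply: cube_degree_forall => t.
case: (w t).
  by apply: cube_degree_ext (cube_degree_coord (h t)) => z; rewrite eqb_id.
apply: cube_degree_ext (cube_degree_negb (cube_degree_coord (h t))) => z.
by rewrite eqbF_neg.
Qed.

(** Each comparison is a branch costing [d], and [k] of them exhaust an interval shorter than
    [2 ^ k]. The continuation [G] consumes the position found, so its degree is paid once, at the
    leaf. *)
Lemma cube_degree_search (a : {ffun I -> bool} -> nat -> nat) (i d : nat) :
  (forall m, cube_degree_le d (fun z => (a z m < i)%N%:R : R)) ->
  forall (G : nat -> {ffun I -> bool} -> R) e,
  (forall m, cube_degree_le e (G m)) ->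
  forall k lo hi, (hi - lo < 2 ^ k)%N ->
  cube_degree_le (k * d + e) (fun z => G (search (a z) i lo hi) z).
Proof.
move=> da G e dG; elim=> [|k IH] lo hi lt_k.
  apply: cube_degree_ext (dG lo) => z.
  rewrite searchE; case: ltnP => // lt_lh.
  by exfalso; move: lt_k; rewrite expn0; lia.
case: (ltnP lo hi) => [lt_lh|le_hl]; last first.
  apply: (@cube_degree_ext _ (G lo)) => [z|].
    by rewrite searchE ltnNge le_hl.
  exact: cube_degree_weaken (leq_addl _ _) (dG lo).
rewrite mulSn -addnA.
(* Removing the midpoint leaves fewer than [2 ^ k] positions on either side. *)
have IHr : (hi - (lo + hi)./2.+1 < 2 ^ k)%N by move: lt_k; rewrite expnS; lia.
have IHl : ((lo + hi)./2 - lo < 2 ^ k)%N by move: lt_k; rewrite expnS; lia.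
apply: cube_degree_ext
  (cube_degree_if (da (lo + hi)./2) (IH _ _ IHr) (IH _ _ IHl)) => z.
by rewrite [in RHS]searchE lt_lh /=; case: ifP.
Qed.

End CubeDegree.

(** * Chebyshev polynomials *)

(* The pair [(T_k y, U_(k-1) y)] of Chebyshev values of the two kinds. *)
Fixpoint chebyshev (R : pzRingType) (y : R) (k : nat) : R * R :=
  if k is k'.+1 then
    let: (t, u) := chebyshev y k' in (y * t + (y ^+ 2 - 1) * u, y * u + t)
  else (1, 0).

(** With [s ^ 2 = y ^ 2 - 1], the recursion multiplies [t + u s] by [y + s], which has norm
    [y ^ 2 - s ^ 2 = 1]. The left-hand side is the norm of [t + u s], hence stays 1. *)
Lemma chebyshev_pell (R : comPzRingType) (y : R) k :
  (chebyshev y k).1 ^+ 2 - (y ^+ 2 - 1) * (chebyshev y k).2 ^+ 2 = 1.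
Proof.
elim: k => [|k]; first by rewrite /= expr0n /= mulr0 subr0 expr1n.
by move=> /=; case: (chebyshev y k) => t u /= IH; rewrite -[RHS]IH; ring.
Qed.

(** For [y ^ 2 <= 1] the Pell identity writes 1 as [T_k ^ 2] plus a nonnegative term. *)
Lemma chebyshev_le1 (R : realFieldType) (y : R) k :
  `|y| <= 1 -> `|(chebyshev y k).1| <= 1.
Proof.
have sq x : (`|x| <= 1) = (x ^+ 2 <= 1 :> R).
  by rewrite -[in RHS]real_normK ?num_real // expr_le1.
rewrite !sq => y1.
rewrite -[leRHS](chebyshev_pell y k) -[leLHS]addr0 lerD2l oppr_ge0.
by rewrite mulr_le0_ge0 ?sqr_ge0 // subr_le0.
Qed.

Lemma chebyshev_growth (R : realFieldType) (e : R) k :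
  0 <= e -> 1 + k%:R ^+ 2 * e <= (chebyshev (1 + e) k).1.
Proof.
(* The bound on [U_(k-1)] must be carried along: in the recursion [2 * e * u] supplies the cross
   term [2 k e] of [(k + 1) ^ 2 * e]. *)
move=> e0; suff: (1 + k%:R ^+ 2 * e <= (chebyshev (1 + e) k).1) &&
  (k%:R <= (chebyshev (1 + e) k).2) by case/andP.
elim: k => [|k] /=; first by rewrite expr0n /= mul0r addr0 !lexx.
case: (chebyshev _ k) => t u /= /andP[t1 u1].
have k0 : 0 <= k%:R :> R by rewrite ler0n.
rewrite -natr1; set K : R := k%:R in t1 u1 k0 *; apply/andP; split; last first.
  by have := mulr_ge0 e0 k0; nra.
have Ke0 := mulr_ge0 (sqr_ge0 K) e0.
have h1 : (1 + e) * (1 + K ^+ 2 * e) <= (1 + e) * t.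
  by apply: ler_wpM2l t1; lra.
have h2 : (2 * e) * K <= (2 * e) * u by apply: ler_wpM2l u1; lra.
have h3 : 0 <= e ^+ 2 * u by apply: mulr_ge0; [exact: sqr_ge0|lra].
have h4 : 0 <= e * (K ^+ 2 * e) by exact: mulr_ge0.
nra.
Qed.

Lemma cube_degree_chebyshev (R : realType) (I : finType) d
    (f : {ffun I -> bool} -> R) k :
  cube_degree_le d f ->
  cube_degree_le (k * d) (fun z => (chebyshev (f z) k).1).
Proof.
move=> df.
(* The second kind is kept one multiple of [d] lower, to pay for its quadratic factor in the
   recursion. *)
have [//] : cube_degree_le (k * d) (fun z => (chebyshev (f z) k).1) /\
  cube_degree_le (k.-1 * d) (fun z => (chebyshev (f z) k).2).
elim: k => [|k [IHt IHu]]; first by split; exact: cube_degree_cst.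
have df2 : cube_degree_le (d + d) (fun z => f z ^+ 2 - 1).
  apply: cube_degreeD (cube_degree_cst _ _ _); exact: cube_degreeM.
(* Since [0.-1 = 0], the general count would give [d + d] for [T_1]; here [T_1 = f] and [U_0 = 1]
   are treated directly. *)
case: k => [|k] in IHt IHu *.
  split=> /=; last first.
    by apply: cube_degree_ext (cube_degree_cst _ _ 1) => z; rewrite mulr0 add0r.
  rewrite mul1n; apply: cube_degree_ext df => z.
  by rewrite mulr1 mulr0 addr0.
split.
  rewrite mulSn; apply: (cube_degree_ext (f := fun z =>
    f z * (chebyshev (f z) k.+1).1 + (f z ^+ 2 - 1) * (chebyshev (f z) k.+1).2)).
    by move=> z /=; case: (chebyshev (f z) k).
  apply: cube_degreeD; first exact: cube_degreeM.
  by rewrite mulSn addnA; apply: cube_degreeM.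
apply: (cube_degree_ext (f := fun z =>
    f z * (chebyshev (f z) k.+1).2 + (chebyshev (f z) k.+1).1)).
  by move=> z /=; case: (chebyshev (f z) k).
by apply: cube_degreeD IHt; rewrite mulSn; apply: cube_degreeM.
Qed.

(* [T_k (1 + e (1 - t)) / T_k (1 + e)] with [e = 2 / (N - 1)] is 1 at t = 0 and
   small on [1, N], which the affine map sends into [-1, 1]. *)
Lemma approx_eq0 (R : realType) (I : finType) (N k d : nat)
    (h : {ffun I -> bool} -> nat) :
  (1 < N)%N -> (N <= k ^ 2)%N -> (forall z, h z <= N)%N ->
  cube_degree_le d (fun z => (h z)%:R : R) ->
  exists2 p : {mpoly R[#|I|]}, approximates p (fun z => h z == 0%N) &
    (mpoly_degree p <= k * d)%N.
Proof.
move=> N1 Nk hN dh; pose e : R := 2 / (N%:R - 1).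
have N1R : 0 < N%:R - 1 :> R by rewrite subr_gt0 ltr1n.
have e0 : 0 < e by rewrite divr_gt0.
have eN : e * (N%:R - 1) = 2 by rewrite mulfVK ?gt_eqF.
(* Growth gives [1 + k ^ 2 * e], and [k ^ 2 * e >= N * e = 2 + e]. The value 3 is what makes the
   error [1 / T] at most 1/3. *)
have T3 : 3 <= (chebyshev (1 + e) k).1.
  apply: le_trans (chebyshev_growth k (ltW e0)).
  have kN : N%:R <= k%:R ^+ 2 :> R by rewrite -natrX ler_nat.
  nra.
set T := (chebyshev (1 + e) k).1 in T3.
have T0 : 0 < T by lra.
have ds : cube_degree_le d (fun z => 1 + e * (1 + -1 * (h z)%:R)).
  apply: cube_degreeD; first exact: cube_degree_cst.
  apply: cube_degreeZ; apply: cube_degreeD; first exact: cube_degree_cst.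
  exact: cube_degreeZ.
have [p pE ps] := cube_degreeZ T^-1 (cube_degree_chebyshev k ds).
exists p; last by rewrite /mpoly_degree; move: ps; lia.
move=> z; rewrite pE; have [->|h0] := eqVneq (h z) 0%N.
  by rewrite mulr0 addr0 mulr1 mulVf ?gt_eqF // subrr normr0 invr_ge0.
rewrite subr0 normrM gtr0_norm ?invr_gt0 //.
have le1 : `|(chebyshev (1 + e * (1 + -1 * (h z)%:R)) k).1| <= 1.
  apply: chebyshev_le1.
  have h1 : 1 <= (h z)%:R :> R by rewrite ler1n lt0n.
  have h2 : (h z)%:R <= N%:R :> R by rewrite ler_nat.
  have h3 : 0 <= e * ((h z)%:R - 1) by apply: mulr_ge0; lra.
  have h4 : 0 <= e * (N%:R - (h z)%:R) by apply: mulr_ge0; lra.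
  by rewrite ler_norml; apply/andP; split; lra.
rewrite -[leRHS]mulr1; apply: ler_pM => //; first by rewrite invr_ge0 ltW.
by rewrite lef_pV2 ?posrE.
Qed.

(** * The predicate as the vanishing of a counter *)

Definition pair_edge (l M : nat)
    (r : 'I_l -> 'I_(2 ^ l) -> 'I_(2 ^ l) -> 'I_(2 ^ l))
    (A : M.-tuple 'I_(2 ^ l)) (u v : 'I_(2 ^ l)) : bool :=
  mem_list A u && mem_list A v && [forall k, mem_list A (r k u v)].

(** The disjunction in the second sum says that Z_{u,v} = 0. Counting in [nat] rules out
    cancellation, so the total vanishes only if every term does. *)
Definition violations (l M : nat)
    (r : 'I_l -> 'I_(2 ^ l) -> 'I_(2 ^ l) -> 'I_(2 ^ l))
    (x : {ffun xcoord l -> bool}) (j : 'I_(2 ^ l))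
    (A : M.-tuple 'I_(2 ^ l)) : nat :=
  \sum_i (~~ mem_list A i && (x (i, j, false) || x (i, j, true))) +
  \sum_(uv : 'I_(2 ^ l) * 'I_(2 ^ l) | uv.1 != uv.2)
    (pair_edge r A uv.1 uv.2 && (x (uv, false) || x (uv.2, uv.2, true))).

Section Violations.

Variables (l M : nat) (r : 'I_l -> 'I_(2 ^ l) -> 'I_(2 ^ l) -> 'I_(2 ^ l)).

Lemma weightE (A : M.-tuple 'I_(2 ^ l)) (x : {ffun xcoord l -> bool}) :
  weight r A x = (\sum_(uv : 'I_(2 ^ l) * 'I_(2 ^ l) | uv.1 != uv.2)
    (pair_edge r A uv.1 uv.2 && (x (uv, false) || x (uv.2, uv.2, true))))%N.
Proof.
rewrite -[RHS]natz natr_sum; apply: eq_bigr => -[u v] _ /=.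
rewrite -mulnb natrM /edge /zprod /pair_edge -!mulnb !natrM; congr (_ * _ * _).
  case: forallP => [memr|/forallP].
    by rewrite big1 // => k _; rewrite memr.
  rewrite negb_forall => /existsP[k /negPf rk].
  by rewrite (bigD1 k) //= rk mul0r.
by case: (x (u, v, false)); case: (x (v, v, true)).
Qed.

Lemma validE (x : {ffun xcoord l -> bool}) j (A : M.-tuple 'I_(2 ^ l)) :
  valid r x j A = (violations r x j A == 0%N).
Proof.
rewrite /violations addn_eq0 /valid weightE; congr (_ && _).
rewrite sum_nat_eq0; apply: eq_forallb => i /=.
by case: (mem_list A i); case: (x (i, j, false)); case: (x (i, j, true)).
Qed.

(** A successful search has compared [i] with an actual entry. The converse can fail, since an
    unsorted list may mislead the search. *)
Lemma mem_list_in (A : M.-tuple 'I_(2 ^ l)) i : mem_list A i -> i \in A.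
Proof.
rewrite /mem_list; case: (posnP M) => [M0|M0].
  (* On an empty list the search stops at position 1, which exceeds [M]. *)
  rewrite searchE ifF; first by case/andP => M1 _; exfalso; lia.
  by rewrite ltnS M0.
case/andP; set p := search _ _ _ _ => pM /eqP pi.
(* The position is in range, so [nth] does not return its default. *)
have p1 : (p.-1 < M)%N by lia.
rewrite -(mem_map val_inj) -[val i]/(nat_of_ord i) -pi; apply: mem_nth.
by rewrite size_map size_tuple.
Qed.

(** Each index contributes at most 1 to the first sum. The pairs in the second lie in the set
    controlled by [sparse_maps] for [S], the indices that the search accepts; [S] is contained in
    the list, so it has at most [M] elements. *)
Lemma violations_le (R : realType) (x : {ffun xcoord l -> bool}) j
    (A : M.-tuple 'I_(2 ^ l)) :
  sparse_maps R r -> M%:R <= list_bound R l ->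
  (violations r x j A <= 2 ^ l + pair_bound l)%N.
Proof.
move=> sr M_le; apply: leq_add.
  rewrite -[X in (_ <= X)%N]card_ord -sum1_card; apply: leq_sum => i _.
  by case: (_ && _).
pose S := [set i | mem_list A i].
have S_le : #|S|%:R <= list_bound R l.
  apply: le_trans M_le; rewrite ler_nat -[X in (_ <= X)%N](size_tuple A).
  apply: leq_trans (card_size A); apply: subset_leq_card.
  by apply/subsetP => i; rewrite inE; apply: mem_list_in.
apply: leq_trans (sr S S_le); rewrite -sum1_card.
rewrite [X in (X <= _)%N]big_mkcond [X in (_ <= X)%N]big_mkcond /=.
apply: leq_sum => -[u v] _ /=; case: ifP => // _.
rewrite !inE /pair_edge /=.
have -> : [forall k, r k u v \in S] = [forall k, mem_list A (r k u v)].
  by apply: eq_forallb => k; rewrite inE.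
by case: (_ && [forall k, _]) => //=; case: (_ || _).
Qed.

End Violations.

Lemma list_len_le (R : realType) l : (list_len R l <= 2 ^ l)%N.
Proof.
rewrite -(ler_nat R); have lb0 : 0 <= list_bound R l by exact: powR_ge0.
have /andP[le_lb _] := truncn_itv lb0; apply: le_trans le_lb _.
rewrite -[leRHS]powRr1 // ler_powR ?ler1n ?expn_gt0 //.
by rewrite ler_pdivrMr ?ltr0n // mul1r ler_nat.
Qed.

(** * The degree of the counter *)

Section ViolationsDegree.

Variables (R : realType) (l M : nat) (name : {ffun 'I_l -> bool} -> 'I_(2 ^ l)).
Variable r : 'I_l -> 'I_(2 ^ l) -> 'I_(2 ^ l) -> 'I_(2 ^ l).

Let A (z : {ffun icoord l M -> bool}) : M.-tuple 'I_(2 ^ l) :=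
  [tuple name (desc_block z (Some m)) | m < M].

Lemma cube_degree_block (m : option 'I_M) (g : 'I_(2 ^ l) -> R) :
  cube_degree_le l (fun z : {ffun icoord l M -> bool} =>
    g (name (desc_block z m))).
Proof.
rewrite -[l in cube_degree_le l]card_ord.
exact: (cube_degree_junta (fun t => inr (m, t)) (g \o name)).
Qed.

(** Positions past the end are covered because [cube_degree_search] asks for all of them; there the
    entry is the constant default 0. *)
Lemma cube_degree_entry m (g : nat -> R) :
  cube_degree_le l (fun z => g (nth 0%N (map val (A z)) m)).
Proof.
have [lt_mM|le_Mm] := ltnP m M.
  apply: cube_degree_ext (cube_degree_block (Some (Ordinal lt_mM)) (g \o val)).
  move=> z /=; set d := name (desc_block z None).
  rewrite (nth_map d) ?size_tuple ?card_ord //.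
  by have := tnth_nth d (A z) (Ordinal lt_mM); rewrite tnth_mktuple => ->.
apply: cube_degree_ext (cube_degree_cst _ _ (g 0%N)) => z.
by rewrite nth_default // size_map size_tuple.
Qed.

Hypothesis M_le : (M <= 2 ^ l)%N.

Lemma cube_degree_mem i :
  cube_degree_le (l.+1 * l + l) (fun z => (mem_list (A z) i)%:R : R).
Proof.
pose a z m := nth 0%N (map val (A z)) m.-1.
(* The final test serves as continuation of the search and reads one more entry. *)
pose G p z : R := ((p <= M)%N && (a z p == i))%:R.
have da m : cube_degree_le l (fun z => (a z m < i)%N%:R : R).
  exact: (cube_degree_entry m.-1 (fun v => (v < i)%N%:R)).
have dG p : cube_degree_le l (G p).
  exact: (cube_degree_entry p.-1 (fun v => ((p <= M)%N && (v == i))%:R)).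
(* The initial interval has length [M <= 2 ^ l], so [l.+1] rounds suffice. *)
have M_lt : (M.+1 - 1 < 2 ^ l.+1)%N.
  by rewrite subSS subn0 expnS; move: (expn_gt0 2 l); lia.
exact: (cube_degree_search da dG M_lt).
Qed.

Lemma cube_degree_pair_edge u v :
  cube_degree_le (l.+2 * (l.+1 * l + l))
    (fun z => (pair_edge r (A z) u v)%:R : R).
Proof.
have dm := cube_degree_mem; rewrite !mulSn addnA.
apply: cube_degree_andb; first exact: cube_degree_andb.
rewrite -[X in (X * _)%N]card_ord.
exact: (cube_degree_forall (b := fun k z => mem_list (A z) (r k u v))).
Qed.

Lemma cube_degree_violations : (5 <= l)%N ->
  cube_degree_le (2 * l ^ 3) (fun z =>
    (violations r (input_part z) (name (desc_block z None)) (A z))%:R : R).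
Proof.
move=> l5.
have dx q : cube_degree_le 1 (fun z : {ffun icoord l M -> bool} =>
    (input_part z q)%:R : R).
  by apply: cube_degree_ext (cube_degree_coord R (inl q)) => z; rewrite ffunE.
apply: (cube_degree_ext (f := fun z =>
  \sum_i (~~ mem_list (A z) i &&
    (input_part z (i, name (desc_block z None), false) ||
     input_part z (i, name (desc_block z None), true)))%:R +
  \sum_(uv : 'I_(2 ^ l) * 'I_(2 ^ l) | uv.1 != uv.2)
    (pair_edge r (A z) uv.1 uv.2 &&
     (input_part z (uv, false) || input_part z (uv.2, uv.2, true)))%:R)).
  by move=> z; rewrite /violations natrD !natr_sum.
apply: cube_degreeD.
  apply: cube_degree_sum => i _.
  (* One membership test, [l] bits to decode [j], and two bits of [x] in that column. *)
  apply: (@cube_degree_weaken _ _ (l.+1 * l + l + (l + (1 + 1)))); first nia.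
  apply: cube_degree_andb; first exact: cube_degree_negb (cube_degree_mem i).
  apply: (cube_degree_bind (h := fun z => name (desc_block z None))
    (F := fun j z => (input_part z (i, j, false) ||
       input_part z (i, j, true))%:R)) => j.
    exact: (cube_degree_block None (fun v => (v == j)%:R)).
  exact: cube_degree_orb.
apply: cube_degree_sum => uv _.
(* This is [l^3 + 4 l^2 + 4 l + 2], which is at most [2 l^3] from [l = 5] on. *)
apply: (@cube_degree_weaken _ _ (l.+2 * (l.+1 * l + l) + (1 + 1))); first nia.
apply: cube_degree_andb; first exact: cube_degree_pair_edge.
exact: cube_degree_orb.
Qed.

End ViolationsDegree.

(** * The bound on the approximate degree *)

Lemma approx_degree_le (R : realType) (I : finType)
    (g : {ffun I -> bool} -> bool) (p : {mpoly R[#|I|]}) :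
  approximates p g -> (approx_degree R g <= mpoly_degree p)%N.
Proof.
move=> pg; rewrite /approx_degree; case: ex_minnP => m _; apply.
by apply/asboolP; exists p.
Qed.

Theorem proposition4p4 (R : realType) :
  exists (C C' : R) (c l0 : nat),
    forall (l : nat) (name : {ffun 'I_l -> bool} -> 'I_(2 ^ l))
      (r : 'I_l -> 'I_(2 ^ l) -> 'I_(2 ^ l) -> 'I_(2 ^ l)),
      (5 <= l)%N -> (l0 <= l)%N -> bijective name -> sparse_maps R r ->
      let n := (2 ^ l)%N in
      let M := list_len R l in
      let L := pair_bound l in
      [/\ exists2 p : {mpoly R[#|icoord l M|]},
            approximates p (phi0 name r) &
            (mpoly_degree p)%:R <= C * (Num.sqrt (n + L)%:R * l%:R ^+ 3),
          C * (Num.sqrt (n + L)%:R * l%:R ^+ 3)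
            <= C' * (Num.sqrt n%:R * l%:R ^+ c)
        & (approx_degree R (@phi0 l M name r))%:R
            <= C' * (Num.sqrt n%:R * l%:R ^+ c)].
Proof.
(* The constant 4 is the product of the 2 in [k_le] and the 2 in the degree [2 * l ^ 3]. The
   exponent 4 is 3 plus one factor [l] that absorbs [L]. *)
exists 4, 4, 4, 0%N => l name r l5 _ _ sr n M L.
have n1 : (1 < n)%N by rewrite -[1%N]/(2 ^ 0)%N ltn_exp2l //; lia.
have M_lb : M%:R <= list_bound R l.
  by have /andP[] := truncn_itv (powR_ge0 _ _ : 0 <= list_bound R l).
have N0 : 1 <= Num.sqrt (n + L)%:R :> R.
  by rewrite -[leLHS]sqrtr1 ler_wsqrtr // ler1n; lia.
(* Rounding up gives [n + L <= k ^ 2]; the extra 1 at most doubles the root, which is at least 1. *)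
pose k := (Num.truncn (Num.sqrt (n + L)%:R : R)).+1.
have k_gt : Num.sqrt (n + L)%:R < k%:R :> R by exact: truncnS_gt.
have k_le : k%:R <= 2 * Num.sqrt (n + L)%:R :> R.
  have /andP[] := truncn_itv (sqrtr_ge0 (n + L)%:R : 0 <= _ :> R).
  rewrite /k -natr1; lra.
have Nk : (n + L <= k ^ 2)%N.
  rewrite -(ler_nat R) natrX -[leLHS]sqr_sqrtr ?ler0n //.
  by rewrite ler_pXn2r ?nnegrE ?sqrtr_ge0 ?ler0n // ltW.
have [p pE pd] : exists2 p : {mpoly R[#|icoord l M|]},
    approximates p (phi0 name r) & (mpoly_degree p <= k * (2 * l ^ 3))%N.
  have [p pE pd] := approx_eq0 (leq_trans n1 (leq_addr L n)) Nk
    (fun z => violations_le _ _ _ sr M_lb)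
    (cube_degree_violations R name r (list_len_le R l) l5).
  by exists p => // z; rewrite /phi0 validE; apply: pE.
have pC : (mpoly_degree p)%:R <= 4 * (Num.sqrt (n + L)%:R * l%:R ^+ 3) :> R.
  apply: (@le_trans _ _ (k * (2 * l ^ 3))%:R); first by rewrite ler_nat.
  rewrite 2!natrM natrX.
  have l3 : 0 <= l%:R ^+ 3 :> R by rewrite exprn_ge0.
  by have := ler_wpM2r l3 k_le; lra.
have CC : 4 * (Num.sqrt (n + L)%:R * l%:R ^+ 3) <=
    4 * (Num.sqrt n%:R * l%:R ^+ 4) :> R.
  rewrite ler_pM2l // [l%:R ^+ 4]exprS mulrA ler_wpM2r ?exprn_ge0 //.
  (* Moving [l] under the root leaves [n + l * n <= n * l ^ 2]. *)
  rewrite -[X in _ <= _ * X]ger0_norm ?ler0n // -sqrtr_sqr -sqrtrM ?ler0n //.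
  rewrite ler_wsqrtr // -natrX -natrM ler_nat /L /pair_bound -/n; nia.
split=> //; first by exists p.
apply: le_trans CC; apply: le_trans pC.
by rewrite ler_nat approx_degree_le.
Qed.
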